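(* Let $A$ and $B$ be irreducible square matrices of size greater than $1$ with entries in $\{0,1\}$ satisfying condition (I). Let $h:X_A\to X_B$ be a homeomorphism, and let $k_1,l_1:X_A\to\mathbb{Z}_+$ and $k_2,l_2:X_B\to\mathbb{Z}_+$ be continuous functions with $$\sigma_B^{k_1(x)}(h(\sigma_A(x)))=\sigma_B^{l_1(x)}(h(x))\ (x\in X_A),\qquad \sigma_A^{k_2(y)}(h^{-1}(\sigma_B(y)))=\sigma_A^{l_2(y)}(h^{-1}(y))\ (y\in X_B),$$ so that $h$ gives a continuous orbit equivalence between $(X_A,\sigma_A)$ and $(X_B,\sigma_B)$. Then the homomorphisms $\Psi_h:C(X_B,\mathbb{Z})\to C(X_A,\mathbb{Z})$ and $\Psi_{h^{-1}}:C(X_A,\mathbb{Z})\to C(X_B,\mathbb{Z})$ (defined in the context) are isomorphisms of abelian groups which are inverse to each other, and: (i) $\Psi_h(1_B)(x)=l_1(x)-k_1(x)$ for $x\in X_A$; (ii) $\Psi_{h^{-1}}(1_A)(y)=l_2(y)-k_2(y)$ for $y\in X_B$; (iii) $[\Psi_h(f)]\in H^A_+$ for every $f\in C(X_B,\mathbb{Z})$ with $[f]\in H^B_+$; (iv) $[\Psi_{h^{-1}}(g)]\in H^B_+$ for every $g\in C(X_A,\mathbb{Z})$ with $[g]\in H^A_+$. Consequently $\Psi_h$ induces an isomorphism $\bar\Psi_h:(H^B,H^B_+)\to(H^A,H^A_+)$, $[f]\mapsto[\Psi_h(f)]$, of ordered groups.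
   Context: For an $N\times N$ matrix $A$ ($N>1$) with entries in $\{0,1\}$, $X_A=\{(x_n)_{n\ge1}\in\{1,\dots,N\}^{\mathbb{N}}: A(x_n,x_{n+1})=1\ \forall n\ge1\}$ with the product topology, and $\sigma_A:X_A\to X_A$ is the shift $(x_n)_n\mapsto(x_{n+1})_n$. Condition (I) is that of Cuntz and Krieger; for an irreducible matrix it says that $A$ is not a permutation matrix, equivalently $X_A$ has no isolated points. $\mathbb{Z}_+=\{0,1,2,\dots\}$. $C(X,\mathbb{Z})$ is the group of continuous integer-valued functions on $X$; $1_A,1_B$ are the constant functions $1$ on $X_A,X_B$. For $f\in C(X_B,\mathbb{Z})$ and $x\in X_A$, $$\Psi_h(f)(x)=\sum_{i=0}^{l_1(x)-1}f(\sigma_B^i(h(x)))-\sum_{j=0}^{k_1(x)-1}f(\sigma_B^j(h(\sigma_A(x)))),$$ and for $g\in C(X_A,\mathbb{Z})$ and $y\in X_B$, $$\Psi_{h^{-1}}(g)(y)=\sum_{i=0}^{l_2(y)-1}g(\sigma_A^i(h^{-1}(y)))-\sum_{j=0}^{k_2(y)-1}g(\sigma_A^j(h^{-1}(\sigma_B(y)))).$$ Empty sums are $0$. Ordered cohomology group: $H^A=C(X_A,\mathbb{Z})/\{\xi-\xi\circ\sigma_A:\xi\in C(X_A,\mathbb{Z})\}$, $[\xi]$ denotes the class of $\xi$, and $H^A_+=\{[\xi]: \xi\in C(X_A,\mathbb{Z}),\ \xi(x)\ge0\ \forall x\in X_A\}$; likewise for $B$. An isomorphism of ordered groups is a group isomorphism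 mapping the positive cone onto the positive cone. *)

(* Defs.v *)
From HB Require Import structures.
From mathcomp Require Import all_boot all_order all_algebra.
From mathcomp Require Import all_classical all_reals all_analysis.

Set Implicit Arguments.
Unset Strict Implicit.
Unset Printing Implicit Defensive.

Import Order.TTheory GRing.Theory Num.Theory.

Local Open Scope classical_set_scope.
Local Open Scope ring_scope.
Local Open Scope quotient_scope.

(* The discrete topologies, declared the way the library does it for nat. *)
HB.instance Definition _ := hasNbhs.Build int principal_filter.
HB.instance Definition _ := Discrete_ofNbhs.Build int erefl.
HB.instance Definition _ (n : nat) := hasNbhs.Build 'I_n principal_filter.
HB.instance Definition _ (n : nat) := Discrete_ofNbhs.Build 'I_n erefl.

Lemma continuous_discreteP (X : topologicalType) (D : discreteTopologicalType)
    (f : X -> D) :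
  continuous f <-> forall x, \forall y \near x, f y = f x.
Proof.
split=> [fc x|fc x]; first exact: (fc x _ (discrete_set1 (f x))).
by apply/discrete_cvg; exact: fc.
Qed.

Notation contZ X := (continuousType X int).

Section ContZ.
Variable X : topologicalType.
Implicit Types f g : contZ X.

Lemma contZ_near f (x : X) : \forall y \near x, f y = f x.
Proof. exact: (continuous_discreteP _).1 (@cts_fun _ _ f) x. Qed.

Definition contZ_const (c : int) : contZ X := cst c.

Fact contZ_opp_subproof f : continuous (fun x => - f x).
Proof.
apply/continuous_discreteP => x.
by apply: filterS (@contZ_near f x) => y ->.
Qed.
Definition contZ_opp f : contZ X := mkcts (@contZ_opp_subproof f).

Fact contZ_add_subproof f g : continuous (fun x => f x + g x).
Proof.
apply/continuous_discreteP => x.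
by apply: filterS2 (@contZ_near f x) (@contZ_near g x) => y -> ->.
Qed.
Definition contZ_add f g : contZ X := mkcts (@contZ_add_subproof f g).

Fact contZ_addA : associative contZ_add.
Proof. by move=> f g k; apply/continuousEP => x; exact: addrA. Qed.
Fact contZ_addC : commutative contZ_add.
Proof. by move=> f g; apply/continuousEP => x; exact: addrC. Qed.
Fact contZ_add0 : left_id (contZ_const 0) contZ_add.
Proof. by move=> f; apply/continuousEP => x; exact: add0r. Qed.
Fact contZ_addN : left_inverse (contZ_const 0) contZ_opp contZ_add.
Proof. by move=> f; apply/continuousEP => x; exact: addNr. Qed.

HB.instance Definition _ :=
  GRing.isZmodule.Build (contZ X) contZ_addA contZ_addC contZ_add0 contZ_addN.

Lemma contZ0E (x : X) : (0 : contZ X) x = 0. Proof. by []. Qed.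
Lemma contZNE f (x : X) : (- f) x = - f x. Proof. by []. Qed.
Lemma contZDE f g (x : X) : (f + g) x = f x + g x. Proof. by []. Qed.
Definition contZE := (contZ0E, contZNE, contZDE).

End ContZ.

Section MatrixConditions.
Variables (N : nat) (A : 'M[int]_N).

Definition zero_one : Prop := forall i j, A i j = 0 \/ A i j = 1.

Definition irreducible_mx : Prop :=
  forall i j, exists2 n, (0 < n)%N & 0 < (A ^+ n) i j.

Definition mx_edge : rel 'I_N := fun i j => A i j == 1.

(* p lists the intermediate vertices of a loop based at i that meets i only
   at its two ends. *)
Definition simple_return (i : 'I_N) (p : seq 'I_N) : bool :=
  path mx_edge i (rcons p i) && (i \notin p).

(* Cuntz and Krieger's condition (I): every state leads to a state at which
   at least two different such loops are based. *)
Definition condition_I : Prop :=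
  forall i, exists2 j, connect mx_edge i j &
    exists p q, [/\ simple_return j p, simple_return j q & p <> q].

End MatrixConditions.

Section MarkovShift.
Variables (N : nat) (A : 'M[int]_N).

(* X_A, with states 'I_N and sequences indexed from 0; set_type carries the
   topology induced by the product of the discrete spaces 'I_N. *)
Definition admissible : set {ptws nat -> 'I_N} :=
  [set x | forall n, A (x n) (x n.+1) = 1].

Definition markov_space : Type := set_type admissible.

HB.instance Definition _ := Topological.on markov_space.

Fact mshift_subproof (x : markov_space) :
  ((fun n => set_val x n.+1) : {ptws nat -> 'I_N}) \in admissible.
Proof. by apply: mem_set => n; exact: (set_valP x n.+1). Qed.
Definition mshift (x : markov_space) : markov_space := SigSub (mshift_subproof x).

Lemma mshift_continuous : continuous mshift.
Proof.
apply: continuous_comp_initial => x.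
apply/cvg_sup; first exact/fmap_filter/nbhs_filter.
move=> n; move: x; apply: (@continuous_comp_initial {ptws nat -> 'I_N} _ _
  (fun f : nat -> 'I_N => f n)) => x.
apply: (@continuous_comp _ _ _ set_val (fun f : {ptws nat -> 'I_N} => f n.+1)).
  exact: initial_continuous.
exact: (@proj_continuous nat (fun=> 'I_N) n.+1).
Qed.

Definition coboundary : {pred contZ markov_space} :=
  fun f => `[< exists xi : contZ markov_space,
                 forall x, f x = xi x - xi (mshift x) >].

Fact coboundary_zmod_closed : zmod_closed coboundary.
Proof.
split=> [|f g /asboolP[u fu] /asboolP[v gv]]; apply/asboolP.
  by exists 0 => x; rewrite !contZE subrr.
exists (u - v) => x; rewrite !contZE fu gv.
by rewrite !opprD !opprK addrACA.
Qed.
HB.instance Definition _ :=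
  GRing.isZmodClosed.Build (contZ markov_space) coboundary coboundary_zmod_closed.

Definition cohomology : zmodType := Quotient.quot coboundary.

Definition cls (f : contZ markov_space) : cohomology := \pi f.

Definition pos_cone : set cohomology :=
  [set c | exists2 xi : contZ markov_space, cls xi = c & forall x, 0 <= xi x].

End MarkovShift.

Arguments mshift {N} A x.
Arguments pos_cone {N} A _.

Section Psi.
Variables (N M : nat) (A : 'M[int]_N) (B : 'M[int]_M).
Variables (h : continuousType (markov_space A) (markov_space B)).
Variables (k l : continuousType (markov_space A) nat).

Definition Psi_fun (f : contZ (markov_space B)) (x : markov_space A) : int :=
  \sum_(0 <= i < l x) f (iter i (mshift B) (h x))
  - \sum_(0 <= j < k x) f (iter j (mshift B) (h (mshift A x))).

Fact Psi_fun_continuous f : continuous (Psi_fun f).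
Proof.
have sc n : continuous (iter n (mshift B)).
  elim: n => [|n IHn] y; first exact: (@cvg_id _ (nbhs y)).
  apply: (@continuous_comp _ _ _ (iter n (mshift B)) (mshift B)).
    exact: (IHn y).
  exact: (@mshift_continuous M B).
have fhc n : continuous (fun x => f (iter n (mshift B) (h x))).
  move=> x; apply: (@continuous_comp _ _ _ h (f \o iter n (mshift B))).
    exact: (@cts_fun _ _ h).
  by apply: continuous_comp; [exact: sc|exact: (@cts_fun _ _ f)].
have sumc (n : nat) : continuous
    (fun x => \sum_(0 <= i < n) f (iter i (mshift B) (h x))).
  elim: n => [|n IHn].
    apply/continuous_discreteP => x; near=> y.
    by rewrite !big_nil.
  apply/continuous_discreteP => x.
  have /continuous_discreteP/(_ x) := IHn.
  have /continuous_discreteP/(_ x) := fhc n.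
  by apply: filterS2 => y E1 E2; rewrite !big_nat_recr //= E1 E2.
apply/continuous_discreteP => x.
have lx := (continuous_discreteP _).1 (@cts_fun _ _ l) x.
have kx := (continuous_discreteP _).1 (@cts_fun _ _ k) x.
have Sl := (continuous_discreteP _).1 (sumc (l x)) x.
have Sk : \forall y \near x,
    \sum_(0 <= j < k x) f (iter j (mshift B) (h (mshift A y)))
    = \sum_(0 <= j < k x) f (iter j (mshift B) (h (mshift A x))).
  exact: (@mshift_continuous N A x _
    ((continuous_discreteP _).1 (sumc (k x)) (mshift A x))).
near=> y; rewrite /Psi_fun.
have -> : l y = l x by near: y.
have -> : k y = k x by near: y.
by congr (_ - _); near: y.
Unshelve. all: by end_near. Qed.

Definition Psi (f : contZ (markov_space B)) : contZ (markov_space A) :=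
  mkcts (@Psi_fun_continuous f).

End Psi.

(* Main.v *)
Require Import Defs.
From HB Require Import structures.
From mathcomp Require Import all_boot all_order all_algebra.
From mathcomp Require Import all_classical all_reals all_analysis.
From mathcomp Require Import zify ring.

(* The Birkhoff sums of Psi_h f are the values of a cocycle on germs
   sigma_B^p u = sigma_B^q v, attached to the germs of powers of sigma_A
   conjugated by h.  The composite of Psi_h and Psi_{h^-1} evaluates this
   cocycle at a germ sigma_B^p = sigma_B^q sigma_B, and since no point is
   isolated p = q + 1, so the composite is the identity.  For positivity, an
   attracting germ of X_A at a periodic point is transported by h to a germ that
   cannot be repelling; hence the sums of Psi_h f over periodic orbits are
   nonnegative when f is, and a function with this property is cohomologous to
   a nonnegative one, by the potential x |-> least weight of a word ending at
   x. *)

Set Implicit Arguments.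
Unset Strict Implicit.
Unset Printing Implicit Defensive.

Import Order.TTheory GRing.Theory Num.Theory.

Local Open Scope classical_set_scope.
Local Open Scope ring_scope.

(** * Cylinders, compactness and gluing of words in a Markov shift *)

Section Cylinders.
Variables (N : nat) (A : 'M[int]_N).
Implicit Types x y z : markov_space A.

Definition coord x (t : nat) : 'I_N := set_val x t.

Definition agree (n : nat) x y : Prop :=
  forall t, (t < n)%N -> coord x t = coord y t.

Lemma markov_ext x y : (forall t, coord x t = coord y t) -> x = y.
Proof. by move=> xy; apply: val_inj; apply/funext => t; exact: xy. Qed.

Lemma coordP x t : A (coord x t) (coord x t.+1) = 1.
Proof. exact: (set_valP x t). Qed.

Lemma markov_mk (f : nat -> 'I_N) :
  (forall t, A (f t) (f t.+1) = 1) -> exists x, forall t, coord x t = f t.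
Proof.
move=> fP; have fA : (f : {ptws nat -> 'I_N}) \in admissible A by exact: mem_set.
by exists (SigSub fA).
Qed.

Lemma coord_iter n x t : coord (iter n (mshift A) x) t = coord x (n + t).
Proof. by elim: n t => [//|n IHn] t; rewrite iterS addSnnS -IHn. Qed.

Lemma agree_leq n m x y : (n <= m)%N -> agree m x y -> agree n x y.
Proof. by move=> nm xy t tn; apply: xy; exact: leq_trans nm. Qed.

Lemma agree_sym n x y : agree n x y -> agree n y x.
Proof. by move=> xy t tn; rewrite xy. Qed.

Lemma agree_iter n m x y : agree (n + m) x y ->
  agree m (iter n (mshift A) x) (iter n (mshift A) y).
Proof. by move=> xy t tm; rewrite !coord_iter xy // ltn_add2l. Qed.

Lemma agree_near n x : \forall y \near x, agree n x y.
Proof.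
elim: n => [|n IHn]; first by near=> y.
have cn : continuous (fun z => coord z n).
  move=> z; apply: (@continuous_comp _ _ _ set_val
    (fun f : {ptws nat -> 'I_N} => f n)); first exact: initial_continuous.
  exact: (@proj_continuous nat (fun=> 'I_N) n).
have := (continuous_discreteP _).1 cn x.
apply: filterS2 IHn => y xy yn t; rewrite ltnS leq_eqVlt => /predU1P[->//|].
exact: xy.
Unshelve. all: by end_near.
Qed.

(** Cylinders form a neighbourhood base: the filter [F] they generate at [x] converges to [x]
    coordinate by coordinate, hence in the product topology. *)
Lemma near_agree x (P : markov_space A -> Prop) :
  (\forall y \near x, P y) -> exists n, forall y, agree n x y -> P y.
Proof.
rewrite /prop_near1 (@nbhsE (initial_topology set_val)) => -[_ [[V oV <-] Vx] VP].
pose F : set_system {ptws nat -> 'I_N} := filter_from setT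
  (fun n => [set f | forall t, (t < n)%N -> coord x t = f t]).
have FF : Filter F.
  apply: filter_from_filter; first by exists 0%N.
  move=> i j _ _; exists (maxn i j) => // f fx; split=> t ti; apply: fx.
    by rewrite (leq_trans ti) // leq_maxl.
  by rewrite (leq_trans ti) // leq_maxr.
have Fx : F --> (set_val x : {ptws nat -> 'I_N}).
  apply/cvg_sup => i U /=.
  rewrite (@nbhsE (initial_topology (fun f : nat -> 'I_N => f i))) => -[_ 
    [[W oW <-] Wx] WU].
  by exists i.+1 => // f fx; apply: WU; rewrite /= -fx.
have [n _ nV] := Fx V (open_nbhs_nbhs (conj oV Vx)).
by exists n => y xy; apply: VP; apply: nV.
Qed.

Lemma closed_admissible : closed (admissible A).
Proof.
move=> f fcl n; have nF : Filter (nbhs (f : {ptws nat -> 'I_N})) := nbhs_filter _.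
have pr t : \forall g \near (f : {ptws nat -> 'I_N}), g t = f t.
  exact: (@proj_continuous nat (fun=> 'I_N) t f _ (discrete_set1 (f t))).
have /fcl[g [gA [<- <-]]] :
    nbhs (f : {ptws nat -> 'I_N}) [set g | g n = f n /\ g n.+1 = f n.+1].
  by apply: filterS2 (pr n) (pr n.+1) => g.
exact: gA.
Qed.

Lemma markov_compact : compact [set: markov_space A].
Proof.
have /compact_near_coveringP cA : compact (admissible A).
  apply: (subclosed_compact closed_admissible
    (@tychonoff nat (fun=> 'I_N) (fun=> setT) _)) => // _.
  exact/finite_compact/finite_finset.
apply/compact_near_coveringP => I F P FF cov.
(* The covering of the subtype becomes one of a subset of the product by asking for [P] at every
   proof of admissibility. *)
have : \forall i \near F, admissible A `<=`
    [set f : {ptws nat -> 'I_N} | forall fA : f \in admissible A, P i (SigSub fA)].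
  apply: cA => f /mem_set fA.
  have [[U J] [/= xU FJ] UJ] := cov (SigSub fA) Logic.I.
  move: xU; rewrite (@nbhsE (initial_topology set_val)) => -[_ [[V oV <-] Vf] VU].
  exists (V, J) => [|[g i] [/= Vg Ji] gA].
    by split=> //; exact: open_nbhs_nbhs.
  by apply: (UJ (SigSub gA, i)); split=> //; apply: VU.
apply: filterS => i Pi x _; case: x => f fA.
exact: (Pi f (set_mem fA) fA).
Qed.

(** Each point has its own radius of constancy; compactness, as a near-covering indexed by radii
    along [\oo], makes one radius serve all points. *)
Lemma contZ_uniform (g : contZ (markov_space A)) :
  exists m, forall x y, agree m x y -> g x = g y.
Proof.
have /compact_near_coveringP := markov_compact.
move/(_ nat \oo (fun m x => forall y, agree m x y -> g x = g y) _) => [x _|m _].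
  have [m mx] := near_agree (contZ_near g x).
  exists (agree m x, [set n | (m <= n)%N]).
    by split; [exact: agree_near | exists m].
  move=> [y n] /= [xy mn] z /(agree_leq mn) yz.
  rewrite (mx _ xy) mx // => t tm.
  by rewrite xy // yz.
by move=> mP; exists m => x y; apply: (mP m (leqnn m)).
Qed.

Lemma contZ_bounded (g : contZ (markov_space A)) :
  exists C : nat, forall x, `|g x| <= C%:Z.
Proof.
have /compact_near_coveringP := markov_compact.
move/(_ nat \oo (fun C x => `|g x| <= C%:Z) _) => [x _|m _].
  exists ([set y | g y = g x], [set n | (`|g x| <= n)%N]).
    by split; [exact: (contZ_near g x) | exists `|g x|%N].
  by move=> [y n] /= [-> xn]; rewrite -abszE lez_nat.
by move=> mP; exists m => x; apply: (mP m (leqnn m)).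
Qed.

Lemma glue n z x : ((0 < n)%N -> A (coord z n.-1) (coord x 0) = 1) ->
  exists y, iter n (mshift A) y = x /\ agree n z y.
Proof.
move=> zx; have [|y yE] := @markov_mk (fun t =>
    if (t < n)%N then coord z t else coord x (t - n)).
  move=> t; case: (ltngtP t.+1 n) => [tn|nt|tn].
  - exact: coordP.
  - by rewrite subSn //; exact: coordP.
  - by rewrite tn subnn; have := zx; rewrite -tn => /(_ isT).
exists y; split=> [|t tn]; last by rewrite yE tn.
by apply: markov_ext => t; rewrite coord_iter yE ltnNge leq_addr addKn.
Qed.

(** An overlap of [m.+1] letters is never empty, so the first letter of [x] already follows the
    prefix of [z] and the junction is admissible. *)
Lemma glue_agree n m z x : agree m.+1 (iter n (mshift A) z) x ->
  exists y, iter n (mshift A) y = x /\ agree (n + m.+1) z y.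
Proof.
move=> zx; case: (@glue n z x) => [n0|y [yx zy]].
  by rewrite -zx // coord_iter addn0 -{2}(prednK n0); exact: coordP.
exists y; split=> // t tnm; case: (ltnP t n) => [/zy//|nt].
rewrite -(subnKC nt) -!coord_iter yx zx //.
by rewrite -(ltn_add2l n) subnKC.
Qed.

(** [y] repeats the first [n] letters of [z]. The recurrence [coord z n = coord z 0] closes the
    loop, and later letters are compared by moving back [n] places. *)
Lemma periodic_agree n m z : (0 < n)%N -> agree m.+1 (iter n (mshift A) z) z ->
  exists y, iter n (mshift A) y = y /\ agree (n + m.+1) z y.
Proof.
move=> n0 zz; have zn t : (t < m.+1)%N -> coord z (n + t) = coord z t.
  by move=> tm; rewrite -coord_iter zz.
have [|y yE] := @markov_mk (fun t => coord z (t %% n)).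
  move=> t; have tn := ltn_pmod t n0.
  have [tE|tE] := eqVneq (t %% n).+1 n.
    rewrite -addn1 -modnDml addn1 tE modnn -(zn 0%N) // addn0 -[in coord z n]tE.
    exact: coordP.
  rewrite -[t.+1]addn1 -modnDml addn1 [in X in A _ X]modn_small ?coordP //.
  by rewrite ltn_neqAle tE.
exists y; split=> [|t tnm].
  by apply: markov_ext => t; rewrite coord_iter !yE modnDl.
rewrite yE; elim/ltn_ind: t tnm => t IHt tnm.
case: (ltnP t n) => [tn|nt]; first by rewrite modn_small.
have tm : (t - n < m.+1)%N by rewrite -(ltn_add2l n) subnKC.
rewrite -(subnKC nt) modnDl zn // IHt //.
  by rewrite -[ltnRHS]subn0 ltn_sub2l // (leq_trans n0).
exact: leq_trans tm (leq_addl _ _).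
Qed.

End Cylinders.

(** * Condition (I) and the absence of isolated points *)

Section NoIsolatedPoint.
Variables (N : nat) (A : 'M[int]_N).
Hypothesis A_I : condition_I A.

Lemma condition_I_edge i : exists j, mx_edge A i j.
Proof.
have [j /connectP[[|k s] /= si sj] [p [q [/andP[pj _] _ _]]]] := A_I i.
  by move: pj; rewrite sj; case: p => [|k p] /= /andP[ik _]; eexists; exact: ik.
by case/andP: si; exists k.
Qed.

Lemma condition_I_point i : exists x : markov_space A, coord x 0 = i.
Proof.
have [next nextP] := choice condition_I_edge.
have [|x xE] := @markov_mk _ A (fun t => iter t next i).
  by move=> t; apply/eqP; exact: nextP.
by exists x; rewrite xE.
Qed.

Lemma follow_path T (x : markov_space A) s : path (mx_edge A) (coord x T) s ->
  exists y, agree T.+1 x y /\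
    forall t, (t < size s)%N -> coord y (T.+1 + t) = nth (coord x T) s t.
Proof.
elim: s T x => [|j s IHs] T x /=; first by exists x.
case/andP => /eqP xj js; have [z zj] := condition_I_point j.
have [|y [yz xy]] := @glue _ A T.+1 x z; first by rewrite zj.
have yj : coord y T.+1 = j by rewrite -zj -yz coord_iter addn0.
have [|w [yw wE]] := IHs T.+1 y; first by rewrite yj.
exists w; split=> [|[|t] ts] /=.
- by move=> t tT; rewrite xy // yw // ltnW.
- by rewrite addn0 -yw.
by rewrite addnS -addSn wE // (set_nth_default (coord y T.+1)).
Qed.

(* If x were isolated, every path from its state would be forced to follow x,
   so the two loops of condition (I) would coincide. *)
Lemma no_isolated_point T (x : markov_space A) :
  exists2 y, agree T x y & y <> x.
Proof.
apply: contrapT => xiso.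
have xuniq y : agree T.+1 x y -> y = x.
  move=> xy; apply: contrapT => yx; apply: xiso; exists y => //.
  exact: agree_leq xy.
have forced s t : path (mx_edge A) (coord x T) s -> (t < size s)%N ->
    nth (coord x T) s t = coord x (T.+1 + t).
  by move=> /follow_path[y [/xuniq-> yE]] ts; rewrite yE.
have [j /connectP[s si sj] [p [q [pj qj]]]] := A_I (coord x T); apply.
wlog pq : p q pj qj / (size p <= size q)%N.
  by move=> H; have [/H->//|/ltnW/H->] := leqP (size p) (size q).
case/andP: pj qj => pj jp /andP[qj jq].
have nthE r t : path (mx_edge A) j (rcons r j) -> (t <= size r)%N ->
    nth (coord x T) (rcons r j) t = coord x (T.+1 + (size s + t)).
  move=> rj tr; rewrite -(forced (s ++ rcons r j)) ?cat_path ?si -?sj //.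
    by rewrite nth_cat ltnNge leq_addr addKn.
  by rewrite size_cat size_rcons ltn_add2l ltnS.
(* If [p] were shorter, the final [j] of its loop would sit at a position inside [q], which avoids
   [j]. *)
have qp : size q = size p.
  apply/eqP; rewrite eqn_leq pq andbT leqNgt; apply: contra jq => lt_pq.
  have := nthE q _ qj pq; rewrite -(nthE p _ pj (leqnn _)).
  by rewrite !nth_rcons lt_pq ltnn eqxx => <-; exact: mem_nth.
apply: (@eq_from_nth _ (coord x T)) => // t tp.
have := nthE q t qj; rewrite qp (ltnW tp) -(nthE p _ pj (ltnW tp)) => /(_ isT).
by rewrite !nth_rcons qp tp => ->.
Qed.

(** For [p < q], each letter of [y] from position [q] on equals the one [q - p] places earlier.
    Points near [x] are thus determined by their first [q] letters, and [x] would be isolated. *)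
Lemma iter_eq_near p q (x : markov_space A) :
  (\forall y \near x, iter p (mshift A) y = iter q (mshift A) y) -> p = q.
Proof.
wlog pq : p q / (p < q)%N.
  move=> H; case: (ltngtP p q) => // [/H//|/H E xpq]; apply/esym/E.
  by apply: filterS xpq => y.
move=> /[dup] /(@nbhs_singleton _ _ _) xpq /near_agree[n nP].
have [y xy] := no_isolated_point (maxn n q) x; case.
have ypq := nP y (agree_leq (leq_maxl _ _) xy).
apply: markov_ext; elim/ltn_ind => t IHt.
have [tq|qt] := ltnP t q; first by rewrite xy // leq_max tq orbT.
rewrite -(subnKC qt) -!coord_iter -ypq -xpq !coord_iter IHt //.
by rewrite -[ltnRHS](subnKC qt) ltn_add2r.
Qed.

End NoIsolatedPoint.

(** * Birkhoff sums *)

Section BirkhoffSum.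
Variables (N : nat) (A : 'M[int]_N).
Implicit Types (f g : contZ (markov_space A)) (x y : markov_space A).

Definition birkhoff f (n : nat) x : int :=
  \sum_(0 <= i < n) f (iter i (mshift A) x).

Lemma birkhoff0 f x : birkhoff f 0 x = 0.
Proof. by rewrite /birkhoff big_nil. Qed.

Lemma birkhoffSr f n x :
  birkhoff f n.+1 x = birkhoff f n x + f (iter n (mshift A) x).
Proof. by rewrite /birkhoff big_nat_recr. Qed.

Lemma birkhoffD f m n x :
  birkhoff f (m + n) x = birkhoff f m x + birkhoff f n (iter m (mshift A) x).
Proof.
elim: n => [|n IHn]; first by rewrite addn0 birkhoff0 addr0.
by rewrite addnS !birkhoffSr IHn -addrA -iterD addnC.
Qed.

Lemma birkhoff_coboundary f (u : contZ (markov_space A)) n x :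
  (forall y, f y = u y - u (mshift A y)) ->
  birkhoff f n x = u x - u (iter n (mshift A) x).
Proof.
move=> fu; elim: n => [|n IHn]; first by rewrite birkhoff0 subrr.
by rewrite birkhoffSr IHn fu addrA subrK.
Qed.

Lemma birkhoff_agree f m n x y :
  (forall z w, agree m z w -> f z = f w) -> agree (n + m) x y ->
  birkhoff f n x = birkhoff f n y.
Proof.
move=> fm xy; apply: eq_big_nat => i /andP[_ ni]; apply/fm/agree_iter.
by apply: agree_leq xy; rewrite leq_add2r ltnW.
Qed.

End BirkhoffSum.

(** * The cocycle on germs and its composition *)

Section OrbitCocycle.
Variables (M : nat) (B : 'M[int]_M) (f : contZ (markov_space B)).
Variable X : topologicalType.
Implicit Types (u v w : X -> markov_space B) (c d : X -> int).

(* c is the value of the groupoid cocycle defined by f on the germ of u -> v. *)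
Definition orbit_cocycle u v c (x : X) : Prop :=
  exists p q, \forall z \near x,
    iter p (mshift B) (u z) = iter q (mshift B) (v z) /\
    c z = birkhoff f p (u z) - birkhoff f q (v z).

Lemma orbit_cocycle_sym u v c x :
  orbit_cocycle u v c x -> orbit_cocycle v u (fun z => - c z) x.
Proof.
move=> [p [q pq]]; exists q, p; apply: filterS pq => z [-> ->].
by rewrite opprB.
Qed.

(** Both identities are shifted to meet at the power [r + q] of [v]; splitting the sum of length
    [r + q] along [v] in its two orders cancels the extra terms. *)
Lemma orbit_cocycle_trans v u w c d x :
  orbit_cocycle u v c x -> orbit_cocycle v w d x ->
  orbit_cocycle u w (fun z => c z + d z) x.
Proof.
move=> [p [q pq]] [r [s rs]]; exists (r + p)%N, (q + s)%N.
apply: filterS2 pq rs => z [E1 ->] [E2 ->]; split.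
  by rewrite !iterD E1 -E2 -!iterD addnC.
have := birkhoffD f r q (v z).
rewrite [(r + p)%N]addnC [(q + s)%N]addnC [(r + q)%N]addnC !birkhoffD E1 -E2.
by move=> E; lia.
Qed.

End OrbitCocycle.

Lemma orbit_cocycle_comp M (B : 'M[int]_M) (f : contZ (markov_space B))
    (X Y : topologicalType) (g : Y -> X) u v c y :
  {for y, continuous g} -> orbit_cocycle f u v c (g y) ->
  orbit_cocycle f (u \o g) (v \o g) (c \o g) y.
Proof. by move=> gc [p [q pq]]; exists p, q; exact: (gc _ pq). Qed.

(** * Classes modulo coboundaries *)

Lemma cls_repr N (A : 'M[int]_N) (c : cohomology A) : cls (repr c) = c.
Proof. exact: reprK. Qed.

Lemma cls_zmod_morphism N (A : 'M[int]_N) : zmod_morphism (@cls N A).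
Proof. by move=> f g; exact: raddfB. Qed.

Lemma cls_eqP N (A : 'M[int]_N) (f g : contZ (markov_space A)) :
  cls f = cls g <->
  exists u : contZ (markov_space A), forall x, f x - g x = u x - u (mshift A x).
Proof.
have -> : (cls f = cls g) <-> (f - g \in coboundary (A := A)).
  by rewrite Quotient.idealrBE; split=> [/eqP|/eqP].
by split=> [/asboolP|] [u fg]; [|apply/asboolP]; exists u.
Qed.

(** * Functions with nonnegative sums over periodic orbits *)

Section NonnegativeCycles.
Variables (N : nat) (A : 'M[int]_N) (g : contZ (markov_space A)).
Hypothesis g_cycle : forall n x, (0 < n)%N -> iter n (mshift A) x = x ->
  0 <= birkhoff g n x.

(* Two equal blocks of the word read by the sum bound a cycle of nonnegative
   weight; cutting such cycles out leaves a word of bounded length. *)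
Lemma birkhoff_lower_bound : exists C : nat, forall n x, - C%:Z <= birkhoff g n x.
Proof.
have [m0 gm0] := contZ_uniform g; have [C gC] := contZ_bounded g.
(* Gluing needs an overlap of at least one letter, hence [m0.+1]. *)
set m := m0.+1; have gm x y : agree m x y -> g x = g y.
  by move=> xy; apply/gm0/(agree_leq _ xy).
pose P := #|{: m.-tuple 'I_N}|; exists (P * C)%N; elim/ltn_ind => n IHn x.
have birkhoff_ge k y : - (k * C)%:Z <= birkhoff g k y.
  elim: k => [|k IHk]; first by rewrite birkhoff0.
  by rewrite birkhoffSr mulSn; have := gC (iter k (mshift A) y); lia.
have [nP|Pn] := leqP n P.
  apply: le_trans (birkhoff_ge n x).
  by rewrite lerN2 lez_nat leq_mul2r nP orbT.
pose block (i : 'I_P.+1) := [tuple coord (iter i (mshift A) x) t | t < m].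
have /injectivePn[i [j ij Eij]] : ~~ injectiveb block.
  by apply/injectiveP => /leq_card; rewrite card_ord ltnn.
wlog {ij} ij : i j Eij / (i < j)%N.
  by move=> H; case: (ltngtP i j) ij => [/H->|/H->|/val_inj->]; rewrite ?eqxx.
have blockE t : (t < m)%N -> coord x (i + t) = coord x (j + t).
  move=> tm; have := congr1 (fun s => tnth s (Ordinal tm)) Eij.
  by rewrite !tnth_mktuple !coord_iter.
have jn : (j < n)%N by apply: leq_trans Pn; exact: ltn_ord.
(* [y] is [x] with the letters at positions [i] to [j - 1] cut out; below, [z] repeats them
   periodically. *)
have [y [yj xy]] : exists y, iter i (mshift A) y = iter j (mshift A) x /\
    agree (i + m) x y.
  by apply: glue_agree => t tm; rewrite !coord_iter blockE.
pose k := (j - i)%N; have kj : (i + k = j)%N by rewrite /k; lia.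
have [||z [zk xz]] := @periodic_agree _ A k m0 (iter i (mshift A) x).
- by rewrite /k; lia.
- move=> t tm; by rewrite -iterD !coord_iter [(k + i)%N]addnC kj blockE.
have cycle_ge0 : 0 <= birkhoff g k (iter i (mshift A) x).
  rewrite (birkhoff_agree gm xz); apply: g_cycle => //; rewrite /k; lia.
have nE : n = (i + (k + (n - j)))%N by lia.
have : - (P * C)%:Z <= birkhoff g (i + (n - j)) y by apply: IHn; lia.
rewrite [X in _ -> _ <= birkhoff g X x]nE !birkhoffD yj (birkhoff_agree gm xy).
rewrite -iterD [(k + i)%N]addnC kj.
by lia.
Qed.

(* The potential of x is the least weight of a word ending at x. *)
Lemma nonneg_cycles_pos_cone : pos_cone A (cls g).
Proof.
have [m0 gm0] := contZ_uniform g; have [C gC] := birkhoff_lower_bound.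
set m := m0.+1; have gm x y : agree m x y -> g x = g y.
  by move=> xy; apply/gm0/(agree_leq _ xy).
(* Weights are shifted by the lower bound [C] into the natural numbers, so that [ex_minn]
   applies. *)
pose W x (k : nat) := `[< exists n y, iter n (mshift A) y = x /\
                          birkhoff g n y = k%:Z - C%:Z >].
have Wex x : exists k, W x k.
  by exists C; apply/asboolP; exists 0%N, x; rewrite birkhoff0 subrr.
(* A word ending at [x] can be grafted onto a nearby [y] without changing its weight, so the
   potential is locally constant. *)
have W_sub x y k : agree m x y -> W x k -> W y k.
  move=> xy /asboolP[n [z [zx zk]]]; apply/asboolP.
  have [|w [wy zw]] := @glue_agree _ A n m0 z y; first by rewrite zx.
  by exists n, w; rewrite -(birkhoff_agree gm zw).
pose u x : int := (ex_minn (Wex x))%:Z.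
have uc : continuous u.
  apply/continuous_discreteP => x; apply: filterS (agree_near m x) => y xy.
  congr Posz; apply: eq_ex_minn => k.
  by apply/idP/idP; apply: W_sub => //; exact: agree_sym.
pose uf : contZ (markov_space A) := mkcts uc.
have usc : continuous (u \o mshift A).
  by move=> x; apply: continuous_comp; [exact: mshift_continuous | exact: uc].
pose us : contZ (markov_space A) := mkcts usc.
exists (g + (uf - us)).
  by apply/cls_eqP; exists uf => x; rewrite !contZE addrAC subrr add0r.
move=> x; change (0 <= g x + (u x - u (mshift A x))); rewrite /u.
case: (ex_minnP (Wex x)) => k /asboolP[n [y [yx yk]]] _.
case: (ex_minnP (Wex (mshift A x))) => l _ l_min.
have := gC n.+1 y; rewrite birkhoffSr yx yk => kC.
(* Lengthening an optimal word by one letter gives [u (mshift A x) <= u x + g x]; [kC] says that the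
   new shifted weight is a natural number. *)
have /l_min : W (mshift A x) (absz (k%:Z + g x)); last by lia.
apply/asboolP; exists n.+1, y; rewrite iterS yx birkhoffSr yx yk; split=> //.
by lia.
Qed.

End NonnegativeCycles.

(** * The map [Psi] on cohomology, and its sums over periodic orbits *)

Section PullBack.
Variables (N M : nat) (A : 'M[int]_N) (B : 'M[int]_M).
Variables (h : continuousType (markov_space A) (markov_space B)).
Variables (k l : continuousType (markov_space A) nat).
Implicit Types (f g : contZ (markov_space B)) (x : markov_space A).

Hypothesis h_orbit : forall x,
  iter (k x) (mshift B) (h (mshift A x)) = iter (l x) (mshift B) (h x).

Lemma PsiE f x :
  Psi h k l f x = birkhoff f (l x) (h x) - birkhoff f (k x) (h (mshift A x)).
Proof. by []. Qed.

Lemma Psi_zmod_morphism : zmod_morphism (Psi h k l).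
Proof.
move=> f g; apply/continuousEP => x; rewrite !contZE !PsiE /birkhoff.
under eq_bigr do rewrite !contZE.
under [X in _ - X = _]eq_bigr do rewrite !contZE.
by rewrite !big_split /= !sumrN; ring.
Qed.

Lemma Psi_const1 x :
  Psi h k l (contZ_const (markov_space B) 1) x = (l x)%:Z - (k x)%:Z.
Proof.
have one n y : birkhoff (contZ_const (markov_space B) 1) n y = n%:Z.
  by elim: n => [|n IHn]; rewrite ?birkhoff0 // birkhoffSr IHn -addn1.
by rewrite PsiE !one.
Qed.

(** Both sums telescope, and their end terms cancel by [h_orbit]. *)
Lemma Psi_coboundary f (u : contZ (markov_space B)) x :
  (forall y, f y = u y - u (mshift B y)) ->
  Psi h k l f x = u (h x) - u (h (mshift A x)).
Proof.
by move=> fu; rewrite PsiE !(birkhoff_coboundary _ _ fu) h_orbit; ring.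
Qed.

Lemma Psi_cls f g : cls f = cls g -> cls (Psi h k l f) = cls (Psi h k l g).
Proof.
move=> /cls_eqP[u fg]; apply/cls_eqP.
pose uh : contZ (markov_space A) := u \o h.
exists uh => x; have <- := @Psi_coboundary (f - g) u x fg.
by rewrite Psi_zmod_morphism !contZE.
Qed.

Lemma Psi_cohomology : exists Psibar : {additive cohomology B -> cohomology A},
  forall f, Psibar (cls f) = cls (Psi h k l f).
Proof.
pose Pb (c : cohomology B) := cls (Psi h k l (repr c)).
have PbE f : Pb (cls f) = cls (Psi h k l f) 
    by apply: Psi_cls; exact: cls_repr.
have Pb_zmod : zmod_morphism Pb.
  move=> c d; rewrite -[c]cls_repr -[d]cls_repr -cls_zmod_morphism !PbE.
  by rewrite Psi_zmod_morphism cls_zmod_morphism.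
pose Pb_additive := GRing.isZmodMorphism.Build _ _ Pb Pb_zmod.
pose Psibar : {additive cohomology B -> cohomology A} :=
  HB.pack_for {additive _ -> _} Pb Pb_additive.
by exists Psibar.
Qed.

Lemma continuous_iter_mshift n : continuous (iter n (mshift A)).
Proof.
elim: n => [|n IHn] x; first exact: (@cvg_id _ (nbhs x)).
apply: (@continuous_comp _ _ _ (iter n (mshift A)) (mshift A)); first exact: IHn.
exact: mshift_continuous.
Qed.

(** [Psi h k l f] is by definition the cocycle on the germ from [h] to [h \o mshift A], as [k] and
    [l] are locally constant; the germs of successive shifts compose. *)
Lemma Psi_cocycle f n x :
  orbit_cocycle f h (h \o iter n (mshift A)) (birkhoff (Psi h k l f) n) x.
Proof.
elim: n => [|n IHn].
  by exists 0%N, 0%N; near=> z; rewrite !birkhoff0 subrr.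
have step y : orbit_cocycle f h (h \o mshift A) (Psi h k l f) y.
  exists (l y), (k y).
  have ly := (continuous_discreteP _).1 (@cts_fun _ _ l) y.
  have ky := (continuous_discreteP _).1 (@cts_fun _ _ k) y.
  by apply: filterS2 ly ky => z <- <-; rewrite -h_orbit -PsiE.
have := orbit_cocycle_comp (@continuous_iter_mshift n x) (step _).
move=> /(orbit_cocycle_trans IHn)[p [q pq]]; exists p, q.
by apply: filterS pq => z; rewrite birkhoffSr.
Unshelve. all: by end_near.
Qed.

(* Near the periodic point x, conjugating the inverse branch of the n-th power
   of the shift by h replaces the first q letters of h x by its first p letters.
   If p < q, this branch would bring the first letter at which a
   point differs from h x closer to the origin, forever. *)
Lemma periodic_expanding n p q x : condition_I A -> injective h ->
  (0 < n)%N -> iter n (mshift A) x = x ->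
  (\forall z \near x, iter p (mshift B) (h z) =
                      iter q (mshift B) (h (iter n (mshift A) z))) ->
  (q <= p)%N.
Proof.
move=> A_I h_inj n0 xn /[dup] /(@nbhs_singleton _ _ _) /= xpq zpq.
rewrite leqNgt; apply/negP => lt_pq; rewrite xn in xpq.
have hq : \forall z \near x, agree q (h x) (h z).
  exact: (@cts_fun _ _ h _ _ (agree_near q (h x))).
have [T TP] := near_agree (filterI zpq hq).
have same t z : agree T.+1 x z -> coord (h z) t = coord (h x) t.
  elim/ltn_ind: t z => t IHt z xz.
  have TPS w : agree T.+1 x w -> _ := fun xw => TP w (agree_leq (leqnSn T) xw).
  have [tq|qt] := ltnP t q; first by rewrite -(TPS z xz).2.
  (* [y] is the image of [z] under the inverse branch: the first [n] letters of [x] followed by [z].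
     Letter [t] of [h z] is then letter [p + (t - q) < t] of [h y]. *)
  have [|y [yz xy]] := @glue_agree _ A n T x z; first by rewrite xn.
  have {}xy : agree T.+1 x y by apply: agree_leq xy; exact: leq_addl.
  have [+ _] := TPS y xy; rewrite yz => ypq.
  rewrite -(subnKC qt) -!coord_iter -ypq -xpq !coord_iter IHt //.
  by rewrite -[ltnRHS](subnKC qt) ltn_add2r.
(* So [h] is constant on a cylinder around [x], against injectivity. *)
have [y xy []] := no_isolated_point A_I T.+1 x.
by apply/h_inj/markov_ext => t; apply: same.
Qed.

(** For a nonnegative representative [g], the sum over a periodic orbit is a difference of Birkhoff
    sums of lengths [p] and [q] at the same point [h x]; since [q <= p], what remains is a sum of
    values of [g]. *)
Lemma Psi_pos_cone f : condition_I A -> injective h ->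
  pos_cone B (cls f) -> pos_cone A (cls (Psi h k l f)).
Proof.
move=> A_I h_inj [g /Psi_cls <- g_ge0]; apply: nonneg_cycles_pos_cone.
move=> n x n0 xn; have [p [q pq]] := Psi_cocycle g n x.
have [_ ->] := nbhs_singleton pq; rewrite /= xn.
have qp : (q <= p)%N.
  by apply: periodic_expanding n0 xn _ => //; apply: filterS pq => z [].
by rewrite -(subnK qp) addnC birkhoffD addrAC subrr add0r sumr_ge0.
Qed.

End PullBack.

(** * Inversion of [Psi] and the isomorphism of ordered groups *)

(* The composite cocycle is that of a germ [sigma^p = sigma^q \o sigma]; as no
   point is isolated p = q.+1, so the germ is that of the shift itself. *)
Lemma Psi_cancel (N M : nat) (A : 'M[int]_N) (B : 'M[int]_M)
    (h : continuousType (markov_space A) (markov_space B))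
    (hinv : continuousType (markov_space B) (markov_space A))
    (k1 l1 : continuousType (markov_space A) nat)
    (k2 l2 : continuousType (markov_space B) nat) :
  condition_I B -> cancel hinv h ->
  (forall x, iter (k1 x) (mshift B) (h (mshift A x)) =
             iter (l1 x) (mshift B) (h x)) ->
  (forall y, iter (k2 y) (mshift A) (hinv (mshift B y)) =
             iter (l2 y) (mshift A) (hinv y)) ->
  cancel (Psi h k1 l1) (Psi hinv k2 l2).
Proof.
move=> B_I hinvK h_orbit hinv_orbit f; apply/continuousEP => y.
have hc : {for y, continuous hinv} by exact: cts_fun.
have hsc : {for y, continuous (hinv \o mshift B)}.
  by apply: continuous_comp; [exact: mshift_continuous | exact: cts_fun].
have yl := orbit_cocycle_comp hc (Psi_cocycle h_orbit f (l2 y) (hinv y)).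
have yk := orbit_cocycle_comp hsc
  (Psi_cocycle h_orbit f (k2 y) (hinv (mshift B y))).
have [r [s rs]] := orbit_cocycle_sym yk.
have ky := (continuous_discreteP _).1 (@cts_fun _ _ k2) y.
have ly := (continuous_discreteP _).1 (@cts_fun _ _ l2) y.
(* Near [y], [hinv_orbit] identifies the source of the reversed second germ with the target of the
   first, so the two can be composed. *)
have {rs} yk' : orbit_cocycle f (h \o iter (l2 y) (mshift A) \o hinv)
    (h \o (hinv \o mshift B))
    (fun z => - birkhoff (Psi h k1 l1 f) (k2 y) (hinv (mshift B z))) y.
  exists r, s; apply: filterS3 rs ly ky => z /= + lz kz.
  by rewrite -lz -hinv_orbit kz.
have [p [q pq]] := orbit_cocycle_trans yl yk'.
have pE : p = q.+1.
  apply: (iter_eq_near B_I (x := y)); apply: filterS pq => z [+ _].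
  by rewrite iterSr /= !hinvK.
have [_] := nbhs_singleton pq; rewrite /= !hinvK PsiE => ->.
by rewrite pE -add1n birkhoffD birkhoffSr birkhoff0 add0r addrK.
Qed.

Theorem theorem5p11 (N M : nat) (A : 'M[int]_N) (B : 'M[int]_M)
    (N_gt1 : (1 < N)%N) (M_gt1 : (1 < M)%N)
    (A01 : zero_one A) (B01 : zero_one B)
    (A_irr : irreducible_mx A) (B_irr : irreducible_mx B)
    (A_I : condition_I A) (B_I : condition_I B)
    (h : continuousType (markov_space A) (markov_space B))
    (hinv : continuousType (markov_space B) (markov_space A))
    (hK : cancel h hinv) (hinvK : cancel hinv h)
    (k1 l1 : continuousType (markov_space A) nat)
    (k2 l2 : continuousType (markov_space B) nat)
    (h_orbit : forall x : markov_space A,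
      iter (k1 x) (mshift B) (h (mshift A x))
      = iter (l1 x) (mshift B) (h x))
    (hinv_orbit : forall y : markov_space B,
      iter (k2 y) (mshift A) (hinv (mshift B y))
      = iter (l2 y) (mshift A) (hinv y)) :
  [/\ zmod_morphism (Psi h k1 l1),
      zmod_morphism (Psi hinv k2 l2),
      cancel (Psi h k1 l1) (Psi hinv k2 l2) &
      cancel (Psi hinv k2 l2) (Psi h k1 l1)] /\
  [/\ forall x : markov_space A,
        Psi h k1 l1 (contZ_const (markov_space B) 1) x = (l1 x)%:Z - (k1 x)%:Z,
      forall y : markov_space B,
        Psi hinv k2 l2 (contZ_const (markov_space A) 1) y = (l2 y)%:Z - (k2 y)%:Z,
      forall f : contZ (markov_space B),
        pos_cone B (cls f) -> pos_cone A (cls (Psi h k1 l1 f)) &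
      forall g : contZ (markov_space A),
        pos_cone A (cls g) -> pos_cone B (cls (Psi hinv k2 l2 g))] /\
  exists Psibar : {additive cohomology B -> cohomology A},
    [/\ forall f : contZ (markov_space B), Psibar (cls f) = cls (Psi h k1 l1 f),
        bijective Psibar &
        Psibar @` pos_cone B = pos_cone A].
Proof.
have h_inj := can_inj hK; have hinv_inj := can_inj hinvK.
have PK := Psi_cancel B_I hinvK h_orbit hinv_orbit.
have PinvK := Psi_cancel A_I hK hinv_orbit h_orbit.
have pos f := Psi_pos_cone h_orbit (f := f) A_I h_inj.
have pos_inv g := Psi_pos_cone hinv_orbit (f := g) B_I hinv_inj.
split; first by split=> //; exact: Psi_zmod_morphism.
split; first by split=> //; exact: Psi_const1.
have [Psibar PsibarE] := Psi_cohomology h_orbit.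
have [Psibar_inv Psibar_invE] := Psi_cohomology hinv_orbit.
exists Psibar; split=> //.
  exists Psibar_inv => c; rewrite -[c]cls_repr.
    by rewrite PsibarE Psibar_invE PK.
  by rewrite Psibar_invE PsibarE PinvK.
apply/seteqP; split=> [_ [c + <-]|c]; rewrite -[c]cls_repr.
  by rewrite PsibarE; exact: pos.
exists (cls (Psi hinv k2 l2 (repr c))); first exact: pos_inv.
by rewrite PsibarE PinvK.
Qed.
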